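(* Let $0<\alpha<1$, $1\le p\le\infty$ and $f\in\ell^p(\mathbb{Z})$. Then for every $n\in\mathbb{Z}$, $$\frac{1}{\Gamma(-\alpha)}\int_0^\infty\frac{T_{t,+}f(n)-f(n)}{t^{1+\alpha}}\,dt=\sum_{j=0}^\infty\Lambda^\alpha(j)f(n+j)\quad\text{and}\quad\frac{1}{\Gamma(-\alpha)}\int_0^\infty\frac{T_{t,-}f(n)-f(n)}{t^{1+\alpha}}\,dt=\sum_{j=0}^\infty\Lambda^\alpha(j)f(n-j).$$ That is, the fractional power $(\delta_{\rm right})^\alpha f$ defined through the semigroup $T_{t,+}$ coincides with Chapman's fractional difference $\triangle^\alpha f(n)=\sum_{m=0}^\infty\binom{-\alpha-1+m}{m}f(n+m)$, and analogously for $(\delta_{\rm left})^\alpha$.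
   Context: For sequences $f$ on $\mathbb{Z}$ and $t\ge0$, $T_{t,\pm}f(n)=\sum_{j=0}^\infty e^{-t}\frac{t^j}{j!}f(n\pm j)$. For $m\in\mathbb{N}_0$, $\Lambda^\alpha(m)=\binom{-\alpha-1+m}{m}=(-1)^m\binom{\alpha}{m}$. With $\delta_{\rm right}f(n)=f(n)-f(n+1)$ and $\delta_{\rm left}f(n)=f(n)-f(n-1)$, the left-hand sides of the two displayed identities are the definitions of $(\delta_{\rm right})^\alpha f(n)$ and $(\delta_{\rm left})^\alpha f(n)$, respectively. *)

(* Defs.v *)
From HB Require Import structures.
From mathcomp Require Import all_boot all_order all_algebra.
From mathcomp Require Import all_classical all_reals all_analysis.
From mathcomp Require Import complex.

Set Implicit Arguments.
Unset Strict Implicit.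
Unset Printing Implicit Defensive.

Import Order.TTheory GRing.Theory Num.Theory.
Import numFieldNormedType.Exports.

Local Open Scope classical_set_scope.
Local Open Scope ring_scope.
Local Open Scope complex_scope.

(* The power-set sigma-algebra, as the library does for [nat], so that l^p(Z)
   is L^p of the counting measure. *)
HB.instance Definition _ := isPointed.Build int 0.
HB.instance Definition _ := @isMeasurable.Build default_measure_display
  int discrete_measurable discrete_measurable0
  discrete_measurableC discrete_measurableU.

Section Defs.
Variable R : realType.
Local Notation C := (R[i]).

Definition in_lp (p : \bar R) (f : int -> C) : Prop :=
  (Lnorm counting p (fun k : int => (complex.Re `|f k|)%:E) < +oo)%E.

(* [R[i]^o] carries the topology of the modulus. *)
Definition csummable (u : nat -> C) : Prop := cvgn (series (u : nat -> C^o)).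

Definition csum (u : nat -> C) : C := limn (series (u : nat -> C^o)).

Definition cintegrable_pos (g : R -> C) : Prop :=
  (@lebesgue_measure R).-integrable `]0, +oo[ (EFin \o (fun t => complex.Re (g t))) /\
  (@lebesgue_measure R).-integrable `]0, +oo[ (EFin \o (fun t => complex.Im (g t))).

Definition cintegral_pos (g : R -> C) : C :=
  (\int[lebesgue_measure]_(t in `]0, +oo[) complex.Re (g t)) +i*
  (\int[lebesgue_measure]_(t in `]0, +oo[) complex.Im (g t)).

Definition Gamma_int (x : R) : R :=
  \int[lebesgue_measure]_(t in `]0, +oo[) (t `^ (x - 1) * expR (- t)).

(* Euler's integral for x > 0, continued to x <= 0 by the functional equation
   Gamma x = Gamma (x + N) / (x (x + 1) ... (x + N - 1)), with the least N such
   that x + N > 0.  The value at the poles 0, -1, -2, ... is 0. *)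
Definition Gamma (x : R) : R :=
  let N := if 0 < x then 0%N else (Num.truncn (- x)).+1 in
  Gamma_int (x + N%:R) / \prod_(k < N) (x + k%:R).

Definition gbinom (x : R) (m : nat) : R :=
  (\prod_(k < m) (x - k%:R)) / m`!%:R.

Definition Lambda (a : R) (m : nat) : R := gbinom (- a - 1 + m%:R) m.

Definition T_plus_term (t : R) (f : int -> C) (n : int) (j : nat) : C :=
  (expR (- t) * (t ^+ j / j`!%:R))%:C * f (n + j%:Z).
Definition T_minus_term (t : R) (f : int -> C) (n : int) (j : nat) : C :=
  (expR (- t) * (t ^+ j / j`!%:R))%:C * f (n - j%:Z).

Definition T_plus t f n : C := csum (T_plus_term t f n).
Definition T_minus t f n : C := csum (T_minus_term t f n).

Definition frac_integrand (T : R -> (int -> C) -> int -> C)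
    (a : R) (f : int -> C) (n : int) (t : R) : C :=
  (T t f n - f n) / (t `^ (1 + a))%:C.

Definition delta_right_pow (a : R) (f : int -> C) (n : int) : C :=
  ((Gamma (- a))^-1)%:C * cintegral_pos (frac_integrand T_plus a f n).
Definition delta_left_pow (a : R) (f : int -> C) (n : int) : C :=
  ((Gamma (- a))^-1)%:C * cintegral_pos (frac_integrand T_minus a f n).

End Defs.

(* Main.v *)
(** An l^p sequence is bounded, so taking real and imaginary parts reduces the
    claim to a bounded real sequence g.  Since the Poisson weights sum to 1,
    (T_t g - g_0) / t^(1+a) = sum_(j >= 1) e^-t t^j / (j! t^(1+a)) (g_j - g_0),
    and the j-th weight integrates to Gamma(j - a) / j! = Lambda_j Gamma(-a).
    The weights are nonnegative for j >= 1 with integrable sum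
    (1 - e^-t) / t^(1+a), so by dominated convergence the integral divided by
    Gamma(-a) is the limit of
    sum_(1 <= j <= n) Lambda_j (g_j - g_0) =
      sum_(j <= n) Lambda_j g_j - g_0 prod_(1 <= k <= n) (1 - a / k),
    where the product tends to 0 because the harmonic series diverges. *)

Require Import Defs.
From mathcomp Require Import all_boot all_order all_algebra.
From mathcomp Require Import all_classical all_reals all_analysis.
From mathcomp Require Import complex.
From mathcomp Require Import measurable_realfun ess_sup_inf ring lra.

Import Order.TTheory GRing.Theory Num.Theory.
Import numFieldNormedType.Exports.
Local Open Scope ring_scope.
Local Open Scope complex_scope.

(** * Boundedness of l^p sequences, and complex series by components *)

Lemma Re_norm_ge0 (R : realType) (z : R[i]) : 0 <= complex.Re `|z|.
Proof. by rewrite normc_def /= sqrtr_ge0. Qed.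

(** A singleton has counting measure 1, so the value at [k] is the integral over [[set k]], and a
    nonnegative integral grows with its domain. *)
Lemma le_integral_counting_int (R : realType) (g : int -> \bar R) (k : int) :
  (forall x, 0 <= g x)%E -> (g k <= \int[counting]_x g x)%E.
Proof.
move=> g0.
have -> : g k = (\int[counting]_(x in [set k]%classic) g x)%E.
  rewrite (eq_integral (cst (g k))); last by move=> x /set_mem ->.
  rewrite (integral_cst (counting : {measure set int -> \bar R})) //=.
  rewrite /counting asboolT; last exact: finite_set1.
  by rewrite fset_set1 finmap.cardfs1 mule1.
apply: ge0_subset_integral => //.
Qed.

Lemma in_lp_bounded (R : realType) (p : \bar R) (f : int -> R[i]) :
  (1%:E <= p)%E -> in_lp p f -> exists M, forall k, complex.Re `|f k| <= M.
Proof.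
case: p => [r| |] //.
- rewrite lee_fin => r1; rewrite /in_lp unlock => fp.
  have r0 : 0 < r by exact: lt_le_trans r1.
  set I := (\int[_]_x _)%E in fp.
  have I0 : (0 <= I)%E by apply: integral_ge0 => x _; exact: poweR_ge0.
  (* The norm is [I] to the power 1/r, so a finite norm forces [I] itself to be finite. *)
  have : (I < +oo)%E.
    by apply: lty_poweRy fp; rewrite invr_neq0 // gt_eqF.
  move=> Ioo.
  have Ifin : I \is a fin_num by rewrite ge0_fin_numE.
  exists ((fine I) `^ r^-1) => k.
  have f0 : 0 <= complex.Re `|f k| by exact: Re_norm_ge0.
  have : ((`|complex.Re (`|f k|)| `^ r)%:E <= I)%E.
    rewrite -poweR_EFin.
    exact: (@le_integral_counting_int R (fun x => `|(complex.Re `|f x|)%:E| `^ r)%E k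
      (fun=> poweR_ge0 _ _)).
  rewrite -(fineK Ifin) lee_fin ger0_norm // => /(@ge0_ler_powR _ r^-1).
  rewrite -powRrM mulfV ?gt_eqF// powRr1//; apply.
  - by rewrite invr_ge0 ltW.
  - by rewrite nnegrE powR_ge0.
  - by rewrite nnegrE fine_ge0.
- move=> _; rewrite /in_lp unlock.
  case: ifPn => [_|].
  + have fE : (abse \o (fun k : int => (complex.Re `|f k|)%:E)) =
      EFin \o (fun k => complex.Re `|f k|).
      by apply/funext => k; congr EFin; rewrite ger0_norm // Re_norm_ge0.
    rewrite fE => /ess_supr_bounded[M [A [mA A0 fM]]].
    (* The exceptional set [A] is null for counting measure. A point violating the bound would lie
       in [A] and give it measure at least 1. *)
    exists M => k; apply: contrapT => fk.
    suff: (1 <= (counting A : \bar R))%E by rewrite A0 lee_fin ler10.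
    apply: (@le_trans _ _ (counting [set k]%classic)).
      rewrite /counting asboolT; last exact: finite_set1.
      by rewrite fset_set1 finmap.cardfs1.
    apply: (@le_measure _ _ _ (counting : {measure set int -> \bar R})); rewrite ?inE //.
    by move=> _ ->; exact: fM.
  (* The default branch of the sup norm concerns a space of measure zero; here the whole space
     contains [[set 0]]. *)
  + move=> /negP[].
    apply: (@lt_le_trans _ _ (counting [set 0%R : int]%classic)).
      rewrite /counting asboolT; last exact: finite_set1.
      by rewrite fset_set1 finmap.cardfs1 lte_fin.
    by apply: (@le_measure _ _ _ (counting : {measure set int -> \bar R})); rewrite ?inE.
Qed.

Lemma cvg_complex (R : realType) (u : nat -> R[i]) (x y : R) :
  ((fun k => complex.Re (u k)) @ \oo --> x)%classic ->
  ((fun k => complex.Im (u k)) @ \oo --> y)%classic ->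
  ((u : nat -> (R[i])^o) @ \oo --> ((x +i* y) : (R[i])^o))%classic.
Proof.
(* The tolerance is a positive element of [R[i]], so its imaginary part vanishes and it is a real
   [e], split evenly between the two components. *)
move=> ux uy; apply/cvgrPdist_lt => -[e e'] /[dup] /ltW/ger0_Im /= -> {e'}.
rewrite ltcR => e0.
have e2 : 0 < e / 2 by rewrite divr_gt0.
near=> k.
have ->: x +i* y - u k = (x - complex.Re (u k))%:C + (y - complex.Im (u k))*i.
  by case: (u k) => b c; simpc.
apply: le_lt_trans (ler_normD _ _) _.
have normR (z : R) : `|z%:C| = `|z|%:C.
  by rewrite normc_def /= expr0n /= addr0 sqrtr_sqr.
have normI (z : R) : `|z *i| = `|z|%:C.
  by rewrite normc_def /= expr0n /= add0r sqrtr_sqr.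
rewrite normR normI -rmorphD ltcR (splitr e) ltrD //.
- by near: k; move/cvgrPdist_lt : ux; apply.
- by near: k; move/cvgrPdist_lt : uy; apply.
Unshelve. all: by end_near. Qed.

Lemma series_complex (R : realType) (u : nat -> R[i]) (n : nat) :
  series u n = series (fun k => complex.Re (u k)) n +i*
               series (fun k => complex.Im (u k)) n.
Proof.
elim: n => [|n IH]; first by rewrite !seriesEnat /= !big_geq.
by rewrite !seriesSr IH; case: (u n).
Qed.

Lemma csum_complex (R : realType) (u : nat -> R[i]) :
  cvgn (series (fun k => complex.Re (u k))) ->
  cvgn (series (fun k => complex.Im (u k))) ->
  csummable u /\
  csum u = limn (series (fun k => complex.Re (u k))) +i*
           limn (series (fun k => complex.Im (u k))).
Proof.
move=> cre cim.
set x := limn _; set y := limn _.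
have H : (series (u : nat -> (R[i])^o) @ \oo --> ((x +i* y) : (R[i])^o))%classic.
  apply: cvg_complex.
  - by under eq_fun do rewrite (series_complex _ u) /=.
  - by under eq_fun do rewrite (series_complex _ u) /=.
split; first by apply/cvg_ex; exists (x +i* y).
exact: (@cvg_lim (R[i])^o (@norm_hausdorff _ _)).
Qed.

(** * Euler's integral *)

Section Euler_integral.
Local Open Scope classical_set_scope.
Local Open Scope ring_scope.
Variable R : realType.
Notation mu := (@lebesgue_measure R).
Implicit Types (x t : R) (n : nat).

Let Ioy : set R := `]0, +oo[.
(* Compact exhaustion of the half-line, away from the singularity at 0. *)
Let exh n : set R := `[n.+1%:R^-1, n.+2%:R].

Lemma bigcup_exh : (\bigcup_n exh n) = Ioy.
Proof.
apply/seteqP; split => t /=.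
  move=> [n _]; rewrite /exh /Ioy /= !in_itv /= andbT => /andP[nt _].
  by apply: lt_le_trans nt; rewrite invr_gt0.
rewrite /Ioy /= in_itv /= andbT => t0.
(* An integer above t + 1/t exceeds both t and 1/t, which handles the two endpoints at once. *)
exists (Num.truncn (t + t^-1)) => //=; rewrite /exh /= in_itv /=.
have := truncnS_gt (t + t^-1); set m := Num.truncn _ => tm.
apply/andP; split.
  rewrite invf_ple ?posrE //; apply: ltW; apply: le_lt_trans tm.
  by rewrite lerDr ltW.
apply: ltW; apply: (@lt_trans _ _ m.+1%:R); last by rewrite ltr_nat.
by apply: le_lt_trans tm; rewrite lerDl invr_ge0 ltW.
Qed.

(** Carries identities from compact intervals, where integration by parts applies, to the half-line
    by monotone convergence. *)
Lemma cvg_integral_exh (f : R -> \bar R) : measurable_fun Ioy f ->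
  (forall t, 0 < t -> (0 <= f t)%E) ->
  ((fun n => \int[mu]_(t in exh n) f t)%E @ \oo --> (\int[mu]_(t in Ioy) f t)%E).
Proof.
move=> mf f0; rewrite -bigcup_exh.
have sub n : (exh n `<=` Ioy) by rewrite -bigcup_exh; exact: bigcup_sup.
apply: ge0_nondecreasing_set_cvg_integral.
- apply/nondecreasing_seqP => n; rewrite subsetEset; apply: subset_itvScc; rewrite ?bnd_simp.
    by rewrite lef_pV2 ?posrE // ler_nat.
  by rewrite ler_nat.
- by move=> n; exact: measurable_itv.
- by move=> n; apply: measurable_funS mf => //; exact: measurable_itv.
- by move=> n t /sub; rewrite /Ioy /= in_itv /= andbT; exact: f0.
Qed.

(** Extended-real valued, so that the functional equation can be proved before finiteness is known
    and then used to establish it. *)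
Definition GammaE x := (\int[mu]_(t in Ioy) (t `^ (x - 1) * expR (- t))%:E)%E.

Lemma GammaE_ge0 x : (0 <= GammaE x)%E.
Proof. by apply: integral_ge0 => t _; rewrite lee_fin mulr_ge0 ?powR_ge0 ?expR_ge0. Qed.

Lemma measurable_Gamma_integrand x (D : set R) :
  measurable_fun D (fun t => t `^ (x - 1) * expR (- t)).
Proof.
apply: measurable_funTS; apply: measurable_funM; first exact: measurable_powR.
by apply: measurableT_comp => //; exact: measurable_expR.
Qed.

Lemma powR_continuous x t : 0 < t -> {for t, continuous (fun s => s `^ x)}.
Proof.
move=> t0; apply: differentiable_continuous; apply/derivable1_diffP.
by apply: derivable_powR; rewrite in_itv /= t0.
Qed.

Lemma expRN_continuous : continuous (fun t : R => expR (- t)).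
Proof. by move=> t; apply: continuous_comp; [exact: opp_continuous|exact: continuous_expR]. Qed.

Lemma within_continuous_powR x (b c : R) : 0 < b ->
  {within `[b, c], continuous (fun s => s `^ x)}.
Proof.
move=> b0; apply: continuous_in_subspaceT => t /set_mem /=.
rewrite in_itv /= => /andP[bt _]; apply: powR_continuous.
exact: lt_le_trans bt.
Qed.

(** Integration by parts against the derivative x t^(x-1) of t^x; 0 < b keeps the interval away from
    the possible singularity at 0. *)
Lemma powR_expR_parts x (b c : R) : 0 < b -> b < c ->
  (x%:E * \int[mu]_(t in `[b, c]) (t `^ (x - 1) * expR (- t))%:E =
   (expR (- c) * c `^ x - expR (- b) * b `^ x)%:E +
   \int[mu]_(t in `[b, c]) (t `^ x * expR (- t))%:E)%E.
Proof.
move=> b0 bc.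
have iab y : mu.-integrable `[b, c] (EFin \o (fun t => t `^ y * expR (- t))).
  apply: continuous_compact_integrable; first exact: segment_compact.
  apply/subspace_continuousP => t tbc; apply: cvgM.
    by move/subspace_continuousP : (@within_continuous_powR y b c b0); apply.
  apply: cvg_within_filter. exact: (@expRN_continuous t).
have contR (F : R -> R) : (forall t, 0 < t -> {for t, continuous F}) ->
    (forall t, 0 < t -> derivable F t 1) -> derivable_oo_LRcontinuous F b c.
  move=> cF dF; split.
  - by move=> t; rewrite in_itv /= => /andP[bt _]; apply/dF/(lt_trans b0 bt).
  - by apply: cvg_at_right_filter; exact: cF.
  - by apply: cvg_at_left_filter; apply: cF; exact: lt_trans b0 bc.
have IP := @integration_by_parts R (fun t => expR (- t)) (fun t => t `^ x)
  (fun t => - expR (- t)) (fun t => x * t `^ (x - 1)) b c bc.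
rewrite -integralZl //; last exact: iab.
under eq_integral => t _ do rewrite -EFinM mulrA mulrC.
rewrite IP.
- congr (_ + _)%E; rewrite -[RHS]oppeK -[in RHS]integral_ge0N; last first.
    by move=> t _; rewrite lee_fin mulr_ge0 ?powR_ge0 ?expR_ge0.
  congr (- _)%E; apply: eq_integral => t _.
  by rewrite -EFinN mulNr mulrC.
- by apply: continuous_subspaceT => t; apply: cvgN; exact: (@expRN_continuous t).
- by apply: contR => t _; [exact: expRN_continuous|exact: ex_derive].
- move=> t _; rewrite derive1E; have : is_derive t 1 (fun t : R => expR (- t)) (- expR (- t)).
    by apply: is_derive_eq; rewrite mulrN1.
  by move=> ?; rewrite derive_val.
- apply/subspace_continuousP => t tbc; apply: cvgM; first exact: cvg_cst.
  by move/subspace_continuousP : (@within_continuous_powR (x - 1) b c b0); apply.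
- apply: contR => t t0; first exact: powR_continuous.
  by apply: derivable_powR; rewrite in_itv /= t0.
- by move=> t; rewrite in_itv /= => /andP[bt _]; apply: powR_derive1; rewrite in_itv /= (lt_trans b0 bt).
Qed.

Lemma powR_expRN_cvg_infty x : 0 < x ->
  (fun n => expR (- n.+2%:R) * n.+2%:R `^ x) @ \oo --> (0 : R).
Proof.
(* Since m > x and e^b >= b^(m+1)/(m+1)!, the quantity e^-b b^x is at most (m+1)!/b for b = n+2. *)
move=> x0; pose m := (Num.truncn x).+1.
apply: (@squeeze_cvgr _ _ _ _ (cst 0) (fun n => m.+1`!%:R * harmonic n)).
- near=> n; rewrite mulr_ge0 ?expR_ge0 ?powR_ge0 //=.
  set b : R := n.+2%:R.
  have b0 : 0 < b by rewrite ltr0n.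
  have b1 : 1 <= b by rewrite ler1n.
  have H1 : b `^ x <= b ^+ m.
    by rewrite -powR_mulrn ?(ltW b0)//; apply/(ler_powR b1)/ltW/truncnS_gt.
  have H2 : b ^+ m.+1 / m.+1`!%:R <= expR b.
    by apply: le_trans (expR_ge1Dxn m (ltW b0)); rewrite lerDr.
  rewrite expRN ler_pdivrMl ?expR_gt0 //.
  apply: (le_trans H1).
  apply: (@le_trans _ _ (b ^+ m.+1 / m.+1`!%:R * (m.+1`!%:R / b))).
    rewrite exprSr -!mulrA ler_peMr ?exprn_ge0 ?(ltW b0)//.
    rewrite [X in _ <= X](_ : _ = 1) //; field.
    by rewrite gt_eqF // pnatr_eq0 -lt0n fact_gt0.
  rewrite ler_pM //.
  - by rewrite divr_ge0 ?exprn_ge0 // ltW.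
  - by rewrite divr_ge0 // ltW.
  - by rewrite ler_wpM2l // lef_pV2 ?posrE // ler_nat.
- exact: cvg_cst.
- by rewrite -(mulr0 m.+1`!%:R); apply: cvgM; [exact: cvg_cst|exact: cvg_harmonic].
Unshelve. all: by end_near. Qed.

Lemma powR_expRN_cvg_origin x : 0 < x ->
  (fun n => expR (- n.+1%:R^-1) * n.+1%:R^-1 `^ x) @ \oo --> (0 : R).
Proof.
move=> x0.
have /cvg_at_rightP/(_ (@harmonic R)) := powR_cvg0 x0 => H.
apply: (@squeeze_cvgr _ _ _ _ (cst 0) (fun n => harmonic n `^ x)).
- near=> n; rewrite mulr_ge0 ?expR_ge0 ?powR_ge0 //=.
  by rewrite ler_piMl ?powR_ge0 // expR_le1 oppr_le0.
- exact: cvg_cst.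
- by apply: H; split => [n|]; [exact: harmonic_gt0|exact: cvg_harmonic].
Unshelve. all: by end_near. Qed.

(** Integration by parts on each [exh n]: the boundary terms vanish at both ends as n grows, and the
    two ways of taking the limit must agree. *)
Lemma GammaE_rec x : 0 < x -> GammaE (x + 1) = (x%:E * GammaE x)%E.
Proof.
move=> x0.
have int0 y t : 0 < t -> (0 <= (t `^ (y - 1) * expR (- t))%:E)%E.
  by move=> _; rewrite lee_fin mulr_ge0 ?powR_ge0 ?expR_ge0.
have mint y : measurable_fun Ioy (fun t => (t `^ (y - 1) * expR (- t))%:E).
  by apply/measurable_EFinP; exact: measurable_Gamma_integrand.
have L : (fun n => x%:E * \int[mu]_(t in exh n) (t `^ (x - 1) * expR (- t))%:E)%E @ \oo
    --> (x%:E * GammaE x)%E.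
  by apply: cvgeZl => //; apply: cvg_integral_exh; [exact: mint|exact: int0].
have Rt : (fun n => x%:E * \int[mu]_(t in exh n) (t `^ (x - 1) * expR (- t))%:E)%E @ \oo
    --> GammaE (x + 1).
  have -> : (fun n => x%:E * \int[mu]_(t in exh n) (t `^ (x - 1) * expR (- t))%:E)%E =
      (fun n => ((expR (- n.+2%:R) * n.+2%:R `^ x - expR (- n.+1%:R^-1) * n.+1%:R^-1 `^ x)%:E
        + \int[mu]_(t in exh n) (t `^ (x + 1 - 1) * expR (- t))%:E)%E).
    apply/funext => n; rewrite powR_expR_parts ?addrK //.
    by apply: (@le_lt_trans _ _ 1); rewrite ?invf_le1 ?ler1n ?ltr1n.
  rewrite -[GammaE (x + 1)]add0e; apply: cvgeD => //.
    apply: cvg_EFin; first exact: nearW.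
    rewrite -[X in _ --> X](subrr 0).
    by apply: cvgB; [exact: powR_expRN_cvg_infty|exact: powR_expRN_cvg_origin].
  by apply: cvg_integral_exh; [exact: mint|exact: int0].
by rewrite -(cvg_lim _ L) // (cvg_lim _ Rt).
Qed.

(** At x = 1 the integrand is the exponential density of rate 1, whose total mass is 1. *)
Lemma GammaE1_lty : (GammaE 1 < +oo)%E.
Proof.
have sub : Ioy `<=` `[0, +oo[.
  by move=> t; rewrite /Ioy /= !in_itv /= !andbT; exact: ltW.
apply: (@le_lt_trans _ _ 1%E); last exact: ltry.
rewrite -(@integral_exponential_pdf R 1 ltr01) //.
have -> : GammaE 1 = (\int[mu]_(t in Ioy) (exponential_pdf 1 t)%:E)%E.
  apply: eq_integral => t /set_mem/sub; rewrite /= in_itv /= andbT => t0.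
  by rewrite exponential_pdfE // subrr powRr0 mulN1r.
apply: ge0_subset_integral => //.
- exact: measurable_itv.
- by apply/measurable_EFinP; exact: measurable_exponential_pdf.
- by move=> t _; rewrite lee_fin exponential_pdf_ge0.
Qed.

(* [t `^ x <= 1 + t] bounds [GammaE (x + 1)] by [GammaE 1 + GammaE 2]. *)
Lemma GammaE_lty x : 0 < x -> x <= 1 -> (GammaE x < +oo)%E.
Proof.
move=> x0 x1.
have : (GammaE (x + 1) < +oo)%E.
  apply: (@le_lt_trans _ _ (GammaE 1 + GammaE (1 + 1))%E); last first.
    by rewrite GammaE_rec // mul1e lte_add_pinfty // GammaE1_lty.
  rewrite /GammaE -ge0_integralD //=; last 5 first.
  - exact: measurable_itv.
  - by move=> t _; rewrite lee_fin mulr_ge0 ?powR_ge0 ?expR_ge0.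
  - by apply/measurable_EFinP; exact: measurable_Gamma_integrand.
  - by move=> t _; rewrite lee_fin mulr_ge0 ?powR_ge0 ?expR_ge0.
  - by apply/measurable_EFinP; exact: measurable_Gamma_integrand.
  apply: ge0_le_integral => //=.
  - exact: measurable_itv.
  - by move=> t _; rewrite lee_fin mulr_ge0 ?powR_ge0 ?expR_ge0.
  - by apply/measurable_EFinP; exact: measurable_Gamma_integrand.
  - apply/measurable_EFinP; apply: measurable_funD; exact: measurable_Gamma_integrand.
  - move=> t; rewrite /Ioy /= in_itv /= andbT => t0.
    rewrite -EFinD lee_fin -mulrDl ler_wpM2r ?expR_ge0 // subrr powRr0 !addrK powRr1 ?(ltW t0) //.
    have [t1|t1] := leP 1 t.
      by rewrite (le_trans (ler1_powR _ _)) // lerDr.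
    apply: (@le_trans _ _ 1); last by rewrite lerDl ltW.
    have := @ge0_ler_powR _ x (ltW x0) t 1; rewrite powR1; apply; rewrite ?nnegrE // ltW //.
(* The finite value is x times [GammaE x] with x > 0, which excludes [GammaE x = +oo]. *)
rewrite GammaE_rec //; case: (GammaE x) (GammaE_ge0 x) => [r _ _| _|] //.
  exact: ltry.
by rewrite gt0_muley.
Qed.

(** For x <= 1 and 0 < t < 1 both t^(x-1) >= 1 and e^-t >= e^-1, so the unit interval alone
    contributes at least e^-1. *)
Lemma GammaE_gt0 x : x <= 1 -> (0 < GammaE x)%E.
Proof.
move=> x1; apply: (@lt_le_trans _ _ (expR (- 1))%:E).
  by rewrite lte_fin expR_gt0.
have sub : `]0, 1[ `<=` Ioy.
  by move=> t; rewrite /Ioy /= !in_itv /= andbT => /andP[].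
have le01 : (\int[mu]_(t in `]0%R, 1%R[) (t `^ (x - 1) * expR (- t))%:E <= GammaE x)%E.
  apply: ge0_subset_integral => //; try exact: measurable_itv.
    by apply/measurable_EFinP; exact: measurable_Gamma_integrand.
  by move=> t _; rewrite lee_fin mulr_ge0 ?powR_ge0 ?expR_ge0.
apply: le_trans le01.
have -> : (expR (- 1))%:E = (\int[mu]_(t in `]0%R, 1%R[) (cst (expR (- 1))%:E t))%E.
  by rewrite integral_cst //= lebesgue_measure_itv /= lte_fin ltr01 -EFinB subr0 mule1.
apply: ge0_le_integral => //=.
- by apply/measurable_EFinP; exact: measurable_Gamma_integrand.
- move=> t; rewrite in_itv /= => /andP[t0 t1]; rewrite lee_fin.
  rewrite -[X in X <= _]mul1r ler_pM ?expR_ge0 //.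
    rewrite -[X in X <= _](powRr0 t); apply: ger_powR; first by rewrite t0 ltW.
    by rewrite subr_le0.
  by rewrite ler_expR lerN2 ltW.
Qed.

End Euler_integral.
Arguments GammaE {R} x.

(** * Partial sums of the coefficients *)


(** Reversing the order of the factors of the binomial product turns -a-1+j-k into k-a, a form in
    which passing from j to j+1 appends one factor. *)
Lemma LambdaE (R : realType) (a : R) (j : nat) :
  Lambda a j = (\prod_(k < j) (k%:R - a)) / j`!%:R.
Proof.
rewrite /Lambda /gbinom; congr (_ / _).
rewrite (reindex_inj rev_ord_inj) /=; apply: eq_bigr => k _.
rewrite natrB; last exact: ltn_ord.
rewrite -natr1; ring.
Qed.

Lemma Lambda0 (R : realType) (a : R) : Lambda a 0 = 1.
Proof. by rewrite LambdaE big_ord0 fact0 divr1. Qed.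

(** A hockey-stick identity. With both sides over factorials, the sum up to n and the next
    coefficient share the product of the (k+1-a), k < n, and adding them leaves the new factor
    n+1-a. *)
Lemma sum_Lambda (R : realType) (a : R) (n : nat) :
  \sum_(0 <= j < n.+1) Lambda a j = \prod_(k < n) (1 - a / k.+1%:R).
Proof.
have factn0 (k : nat) : k`!%:R != 0 :> R by rewrite pnatr_eq0 -lt0n fact_gt0.
have S0 (k : nat) : k.+1%:R != 0 :> R by rewrite pnatr_eq0.
have -> : \prod_(k < n) (1 - a / k.+1%:R) = (\prod_(k < n) (k.+1%:R - a)) / n`!%:R.
  elim: n => [|n IH]; first by rewrite !big_ord0 fact0 divr1.
  rewrite !big_ord_recr /= IH factS natrM; field.
  by rewrite factn0 /= addrC natr1 S0.
elim: n => [|n IH].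
  by rewrite big_nat1 Lambda0 big_ord0 fact0 divr1.
rewrite big_nat_recr //= IH LambdaE factS natrM big_ord_recl [in RHS]big_ord_recr /=.
rewrite (eq_bigr (fun k : 'I_n => k.+1%:R - a)); last by [].
rewrite -natr1; field.
by rewrite factn0 /= natr1 S0.
Qed.

(** The factors are nonnegative as a < 1, and 1 - x <= e^-x bounds the product by the exponential of
    -a times a harmonic sum. *)
Lemma prod_onem_div_cvg0 (R : realType) (a : R) : 0 < a -> a < 1 ->
  ((fun n => \prod_(k < n) (1 - a / k.+1%:R)) @ \oo --> (0 : R))%classic.
Proof.
move=> a0 a1.
have P0 (k : nat) : 0 <= 1 - a / k.+1%:R.
  rewrite subr_ge0 ler_pdivrMr ?ltr0n // mul1r (le_trans (ltW a1)) //.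
  by rewrite ler1n.
have Hoo : (series (@harmonic R) @ \oo --> +oo%R)%classic.
  apply: nondecreasing_dvgn_lt; last exact: dvg_harmonic.
  by apply: nondecreasing_series => k _ _; exact: harmonic_ge0.
apply: (@squeeze_cvgr _ _ _ _ (cst 0) (fun n => expR (- (a * series (@harmonic R) n)))).
- near=> n; apply/andP; split; first by apply: prodr_ge0.
  rewrite seriesEnat /= big_mkord mulr_sumr -sumrN expR_sum.
  apply: ler_prod => k _; rewrite P0 /=.
  exact: expR_ge1Dx.
- exact: cvg_cst.
- apply: (cvg_comp (fun n => a * series (@harmonic R) n) (fun x => expR (- x)) _ (@cvgr_expR R)).
  apply/cvgryPge => A; move/cvgryPge : Hoo => /(_ (A / a)).
  by apply: filterS => n; rewrite ler_pdivrMr // mulrC.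
Unshelve. all: by end_near. Qed.

(** * The real case *)

Section Fractional_difference.
Local Open Scope classical_set_scope.
Local Open Scope ring_scope.
Variables (R : realType) (a : R).
Hypotheses (a_gt0 : 0 < a) (a_lt1 : a < 1).
Notation mu := (@lebesgue_measure R).
Implicit Types (t : R) (n j : nat).

Let G : R := Gamma_int (1 - a).

Lemma GammaE_fin : GammaE (1 - a) = G%:E.
Proof.
rewrite /G /Gamma_int /Rintegral fineK // ge0_fin_numE; last exact: GammaE_ge0.
by apply: GammaE_lty; rewrite ?subr_gt0 // gerBl ltW.
Qed.

Lemma Gamma_int_onem_gt0 : 0 < G.
Proof. by rewrite -lte_fin -GammaE_fin GammaE_gt0 // gerBl ltW. Qed.

(** For 0 < a < 1 the continuation of [Gamma] to -a takes exactly one step, N = 1, which divides by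
    the single factor -a. *)
Lemma Gamma_opp : Gamma (- a) = - (G / a).
Proof.
rewrite /Gamma oppr_gt0 ltNge (ltW a_gt0) /= opprK.
have -> : Num.truncn a = 0%N.
  by apply/eqP; rewrite -leqn0 leqNgt truncn_gt0 -ltNge.
by rewrite big_ord1 addr0 addrC invrN mulrN.
Qed.

Lemma Gamma_opp_lt0 : Gamma (- a) < 0.
Proof. by rewrite Gamma_opp oppr_lt0 divr_gt0 // Gamma_int_onem_gt0. Qed.

Lemma GammaE_shift j :
  GammaE (j.+1%:R - a) = ((\prod_(k < j) (k.+1%:R - a)) * G)%:E.
Proof.
elim: j => [|j IH]; first by rewrite big_ord0 mul1r GammaE_fin.
have -> : j.+2%:R - a = (j.+1%:R - a) + 1 by rewrite -(natr1 j.+1); ring.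
rewrite GammaE_rec; last by rewrite subr_gt0 (lt_le_trans a_lt1) // ler1n.
by rewrite IH big_ord_recr /= -EFinM mulrA [_ * (_ - a)]mulrC.
Qed.

(** Near 0 this behaves like t^(j-1-a), which is integrable only for j >= 1; hence the index [j.+1]
    wherever it is integrated. *)
Definition poisson_kernel j t : R :=
  (expR (- t) * (t ^+ j / j`!%:R)) / t `^ (1 + a).

Lemma poisson_kernel_ge0 j t : 0 < t -> 0 <= poisson_kernel j t.
Proof.
move=> t0; rewrite /poisson_kernel.
by rewrite divr_ge0 ?powR_ge0 // mulr_ge0 ?expR_ge0 // divr_ge0 // exprn_ge0 // ltW.
Qed.

Lemma measurable_poisson_kernel j (D : set R) : measurable_fun D (poisson_kernel j).
Proof.
apply: measurable_funTS; apply: measurable_funM.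
  apply: measurable_funM.
    by apply: measurableT_comp => //; exact: measurable_expR.
  by apply: measurable_funM => //; exact: measurable_funX.
apply: (eq_measurable_fun (fun t => t `^ (- (1 + a)))) => [t _|].
  by rewrite powRN.
exact: measurable_powR.
Qed.

(** The kernel is a Gamma integrand of parameter j+1-a divided by (j+1)!. The leading factor -a of
    the product in [Lambda a j.+1] cancels the denominator of [Gamma (- a)]. *)
Lemma integral_poisson_kernel j :
  (\int[mu]_(t in `]0%R, +oo[) (poisson_kernel j.+1 t)%:E)%E =
  (Lambda a j.+1 * Gamma (- a))%:E.
Proof.
have E t : t \in `]0, +oo[ -> poisson_kernel j.+1 t =
    (j.+1)`!%:R^-1 * (t `^ (j.+1%:R - a - 1) * expR (- t)).
  rewrite /= in_itv /= andbT => t0; rewrite /poisson_kernel.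
  have -> : j.+1%:R - a - 1 = j.+1%:R - (1 + a) by ring.
  rewrite powRB; last by rewrite (gt_eqF t0) implybT.
  by rewrite powR_mulrn ?(ltW t0) //; ring.
under eq_integral => t /set_mem t0 do rewrite E // EFinM.
rewrite ge0_integralZl //; last 2 first.
- by apply/measurable_EFinP; exact: measurable_Gamma_integrand.
- by move=> t _; rewrite lee_fin mulr_ge0 ?powR_ge0 ?expR_ge0.
have := GammaE_shift j; rewrite /GammaE => ->.
rewrite -EFinM LambdaE Gamma_opp big_ord_recl /= sub0r.
rewrite (eq_bigr (fun k : 'I_j => k.+1%:R - a)); last by [].
congr EFin; field.
by rewrite (gt_eqF a_gt0) pnatr_eq0 -lt0n fact_gt0.
Qed.

Lemma integrable_poisson_kernel j :
  mu.-integrable `]0, +oo[ (EFin \o poisson_kernel j.+1).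
Proof.
apply/integrableP; split.
  by apply/measurable_EFinP; exact: measurable_poisson_kernel.
under eq_integral => t /set_mem.
  rewrite /= in_itv /= andbT => t0.
  rewrite ger0_norm ?poisson_kernel_ge0 //.
over.
by rewrite integral_poisson_kernel ltry.
Qed.

(** The total of the kernels with j >= 1: the Poisson weights sum to 1 and the one at j = 0 is e^-t.
    Up to a constant it is the dominating function used below. *)
Let kernel_sum t : R := (1 - expR (- t)) / t `^ (1 + a).

Lemma sum_poisson_kernel n t :
  \sum_(j < n) poisson_kernel j.+1 t =
  (expR (- t) * series (exp_coeff t) n.+1 - expR (- t)) / t `^ (1 + a).
Proof.
rewrite seriesEnat /= big_mkord big_ord_recl /= /exp_coeff /= expr0 fact0 divr1.
rewrite mulrDr mulr1 addrC addKr mulr_sumr mulr_suml.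
by apply: eq_bigr.
Qed.

Lemma series_exp_coeff_cvg t : (fun n => expR (- t) * series (exp_coeff t) n) @ \oo --> (1 : R).
Proof.
rewrite -(expRxMexpNx_1 t) mulrC; apply: cvgM; first exact: cvg_cst.
exact: is_cvg_series_exp_coeff.
Qed.

Lemma cvg_sum_poisson_kernel t :
  (fun n => \sum_(j < n) poisson_kernel j.+1 t) @ \oo --> kernel_sum t.
Proof.
under eq_fun do rewrite sum_poisson_kernel.
apply: cvgM; last exact: cvg_cst.
apply: cvgB; last exact: cvg_cst.
have := series_exp_coeff_cvg t.
by rewrite -[X in X -> _](cvg_shiftS (fun n => expR (- t) * series (exp_coeff t) n)).
Qed.

Lemma sum_poisson_kernel_le n t : 0 < t ->
  \sum_(j < n) poisson_kernel j.+1 t <= kernel_sum t.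
Proof.
move=> t0.
rewrite -(cvg_lim (@Rhausdorff R) (cvg_sum_poisson_kernel t)).
apply: (nondecreasing_cvgn_le (u_ := fun n => \sum_(j < n) poisson_kernel j.+1 t)).
  apply/nondecreasing_seqP => m; rewrite big_ord_recr /= lerDl.
  exact: poisson_kernel_ge0.
by apply/cvg_ex; exists (kernel_sum t); exact: cvg_sum_poisson_kernel.
Qed.

Lemma measurable_kernel_sum (D : set R) : measurable_fun D kernel_sum.
Proof.
apply: measurable_funTS; apply: (measurable_fun_cvg (h := fun n t => \sum_(j < n) poisson_kernel j.+1 t)).
  by move=> n; apply: measurable_sum => j; exact: measurable_poisson_kernel.
by move=> t _; exact: cvg_sum_poisson_kernel.
Qed.

Lemma kernel_sum_ge0 t : 0 < t -> 0 <= kernel_sum t.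
Proof.
by move=> t0; rewrite divr_ge0 ?powR_ge0 // subr_ge0 expR_le1 oppr_le0 ltW.
Qed.

(** All the coefficients together sum to 0, so omitting [Lambda a 0 = 1] leaves -1. *)
Lemma cvg_sum_Lambda : (fun n => \sum_(j < n) Lambda a j.+1) @ \oo --> (-1 : R).
Proof.
have -> : (fun n => \sum_(j < n) Lambda a j.+1) =
    (fun n => \prod_(k < n) (1 - a / k.+1%:R) - 1).
  apply/funext => n; rewrite -sum_Lambda big_mkord big_ord_recl Lambda0.
  by rewrite addrC addKr.
rewrite -[X in _ --> X]sub0r; apply: cvgB; last exact: cvg_cst.
exact: prod_onem_div_cvg0.
Qed.

(** Monotone convergence: the partial sums of kernels have integrals tending to - Gamma(-a), which
    is finite. *)
Lemma integrable_kernel_sum : mu.-integrable `]0, +oo[ (EFin \o kernel_sum).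
Proof.
apply/integrableP; split.
  by apply/measurable_EFinP; exact: measurable_kernel_sum.
pose g n t := (\sum_(j < n) poisson_kernel j.+1 t)%:E.
have H := @cvg_monotone_convergence _ _ _ mu `]0, +oo[ (measurable_itv _) g _ _ _.
have gE n : (\int[mu]_(t in `]0%R, +oo[) g n t)%E = (\sum_(j < n) Lambda a j.+1 * Gamma (- a))%:E.
  rewrite /g; under eq_integral do rewrite -sumEFin.
  rewrite integral_sum //; last by move=> j; exact: integrable_poisson_kernel.
  by rewrite -sumEFin; apply: eq_bigr => j _; exact: integral_poisson_kernel.
have -> : (\int[mu]_(t in `]0%R, +oo[) `|(EFin \o kernel_sum) t|)%E =
   (\int[mu]_(t in `]0%R, +oo[) limn (g^~ t))%E.
  apply: eq_integral => t /set_mem; rewrite /= in_itv /= andbT => t0.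
  rewrite ger0_norm ?kernel_sum_ge0 //; apply/esym/cvg_lim => //.
  by apply: cvg_EFin; [exact: nearW|exact: cvg_sum_poisson_kernel].
rewrite (_ : (\int[mu]_(t in `]0%R, +oo[) limn (g^~ t))%E = (- 1 * Gamma (- a))%:E) ?ltry //.
have {}H : (\int[mu]_(t in `]0%R, +oo[) g n t)%E @[n --> \oo] -->
    (\int[mu]_(t in `]0%R, +oo[) limn (g^~ t))%E.
  apply: H.
  - move=> n; apply/measurable_EFinP; apply: measurable_sum => j.
    exact: measurable_poisson_kernel.
  - move=> n t; rewrite /= in_itv /= andbT => t0; rewrite lee_fin sumr_ge0 // => j _.
    exact: poisson_kernel_ge0.
  - move=> t; rewrite /= in_itv /= andbT => t0; apply/nondecreasing_seqP => n.
    by rewrite lee_fin big_ord_recr /= lerDl poisson_kernel_ge0.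
rewrite (funext gE) in H; apply: (cvg_unique _ H) => //=.
apply: cvg_EFin; first exact: nearW.
under eq_fun do rewrite -mulr_suml.
by apply: cvgM; [exact: cvg_sum_Lambda|exact: cvg_cst].
Qed.

(** * Dominated convergence for a bounded real sequence *)

Section bounded_sequence.
(** [g] is a real or imaginary part of the values of f read outward from the base point, in either
    direction, so both semigroups are one case. *)
Variables (g : nat -> R) (M : R).
Hypothesis gM : forall j, `|g j| <= M.

Let term t j : R := expR (- t) * (t ^+ j / j`!%:R) * g j.

Definition poisson_mean t : R := limn (series (term t)).

Definition frac_quotient t : R := (poisson_mean t - g 0%N) / t `^ (1 + a).

Lemma is_cvg_poisson_mean t : 0 <= t -> cvgn (series (term t)).
Proof.
move=> t0; apply: normed_cvg.
apply: (@series_le_cvg _ _ (fun j => expR (- t) * M * exp_coeff t j)) => [j|j|j|].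
- exact: normr_ge0.
- rewrite mulr_ge0 ?exp_coeff_ge0 // mulr_ge0 ?expR_ge0 //.
  by rewrite (le_trans _ (gM 0%N)).
- rewrite /= /term normrM [leRHS]mulrAC.
  rewrite ger0_norm; last by rewrite mulr_ge0 ?expR_ge0 // divr_ge0 // exprn_ge0.
  by rewrite ler_wpM2l // mulr_ge0 ?expR_ge0 // exp_coeff_ge0.
rewrite (_ : series _ = fun n => expR (- t) * M * series (exp_coeff t) n).
  by apply: is_cvgM; [exact: is_cvg_cst|exact: is_cvg_series_exp_coeff].
by apply/funext => n; rewrite !seriesEnat /= mulr_sumr.
Qed.

(** Subtracting g 0 in each term removes the j = 0 kernel, the only one that is not integrable. *)
Let approx n t : R := \sum_(j < n) poisson_kernel j.+1 t * (g j.+1 - g 0%N).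

Lemma cvg_approx_quotient t : 0 < t -> approx ^~ t @ \oo --> frac_quotient t.
Proof.
move=> t0.
(* The n kernels of index 1 to n match partial sums of length n+1, whose terms at j = 0 cancel. *)
have -> : approx ^~ t = fun n => (series (term t) n.+1 -
    expR (- t) * series (exp_coeff t) n.+1 * g 0%N) / t `^ (1 + a).
  apply/funext => n; rewrite /approx !seriesEnat /= !big_mkord.
  rewrite mulr_sumr mulr_suml -sumrB mulr_suml big_ord_recl /= /term /exp_coeff /=.
  rewrite subrr mul0r add0r; apply: eq_bigr => j _.
  by rewrite /poisson_kernel -mulrBr mulrAC.
apply: cvgM; last exact: cvg_cst.
rewrite -[X in _ - X]mul1r; apply: cvgB.
  have := is_cvg_poisson_mean t (ltW t0).
  by rewrite -[X in X -> _](cvg_shiftS (series (term t))).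
apply: cvgM; last exact: cvg_cst.
have := series_exp_coeff_cvg t.
by rewrite -[X in X -> _](cvg_shiftS (fun n => expR (- t) * series (exp_coeff t) n)).
Qed.

Lemma approx_le n t : 0 < t -> `|approx n t| <= (M + M) * kernel_sum t.
Proof.
move=> t0; rewrite /approx.
apply: (le_trans (ler_norm_sum _ _ _)).
(* Each difference of two values of [g] is at most 2M in absolute value. *)
apply: (@le_trans _ _ ((M + M) * \sum_(j < n) poisson_kernel j.+1 t)).
  rewrite mulr_sumr; apply: ler_sum => j _.
  rewrite normrM mulrC (ger0_norm (poisson_kernel_ge0 _ _ t0)).
  rewrite ler_wpM2r ?poisson_kernel_ge0 //.
  by rewrite (le_trans (ler_normB _ _)) // lerD.
rewrite ler_wpM2l ?sum_poisson_kernel_le //.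
by rewrite addr_ge0 // (le_trans _ (gM 0%N)).
Qed.

Lemma measurable_approx n (D : set R) : measurable_fun D (approx n).
Proof.
apply: measurable_sum => j; apply: measurable_funM => //.
exact: measurable_poisson_kernel.
Qed.

Lemma integrable_approx_term j :
  mu.-integrable `]0, +oo[
    (fun t => (poisson_kernel j.+1 t * (g j.+1 - g 0%N))%:E).
Proof.
have := integrableZr _ (g j.+1 - g 0%N) (integrable_poisson_kernel j).
by apply; exact: measurable_itv.
Qed.

Lemma integral_approx n :
  (\int[mu]_(t in `]0%R, +oo[) (approx n t)%:E)%E =
  (Gamma (- a) * (series (fun j => Lambda a j * g j) n.+1 -
                  g 0%N * \prod_(k < n) (1 - a / k.+1%:R)))%:E.
Proof.
rewrite /approx; under eq_integral do rewrite -sumEFin.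
rewrite integral_sum //; last exact: integrable_approx_term.
(* Read backwards, [sum_Lambda] makes the right-hand side a sum of Lambda_j (g_j - g_0), whose term
   at j = 0 vanishes. *)
rewrite -sum_Lambda seriesEnat /= !big_mkord mulr_sumr -sumrB mulr_sumr.
rewrite big_ord_recl /= Lambda0 mul1r mulr1 subrr mulr0 add0r -sumEFin.
apply: eq_bigr => j _; under eq_integral do rewrite EFinM.
rewrite integralZr //; last exact: integrable_poisson_kernel.
have := integral_poisson_kernel j => /= ->; rewrite -EFinM; congr EFin.
rewrite /bump /= add1n; ring.
Qed.

Lemma frac_power_dominated :
  mu.-integrable `]0, +oo[ (EFin \o frac_quotient) /\
  (\int[mu]_(t in `]0%R, +oo[) (approx n t)%:E)%E @[n --> \oo] -->
    (\int[mu]_(t in `]0%R, +oo[) (frac_quotient t)%:E)%E.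
Proof.
have mf : measurable_fun (`]0%R, +oo[ : set R) frac_quotient.
  apply: (measurable_fun_cvg (h := approx)).
    by move=> n; exact: measurable_approx.
  by move=> t; rewrite /= in_itv /= andbT; exact: cvg_approx_quotient.
have := @dominated_convergence _ _ _ mu `]0, +oo[ (measurable_itv _)
  (fun n t => (approx n t)%:E) (EFin \o frac_quotient)
  (fun t => ((M + M) * kernel_sum t)%:E).
case=> //.
- by move=> n; apply/measurable_EFinP; exact: measurable_approx.
- exact/measurable_EFinP.
- apply: nearW => t; rewrite /= in_itv /= andbT => t0.
  by apply: cvg_EFin; [exact: nearW|exact: cvg_approx_quotient].
- have := integrableZl _ (M + M) integrable_kernel_sum.
  by apply; exact: measurable_itv.
- apply: nearW => t n; rewrite /= in_itv /= andbT => t0.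
  by rewrite lee_fin; exact: approx_le.
Qed.

(** Convergence of the series is obtained here along with its value: the integrals of [approx]
    converge, and the series differs from them, divided by Gamma(-a), only by g 0 times a vanishing
    product. *)
Lemma cvg_Lambda_series :
  series (fun j => Lambda a j * g j) @ \oo -->
    (Gamma (- a))^-1 * \int[mu]_(t in `]0, +oo[) frac_quotient t.
Proof.
have [fi] := frac_power_dominated; set I := \int[mu]_(t in `]0, +oo[) _.
have -> : (\int[mu]_(t in `]0%R, +oo[) (frac_quotient t)%:E)%E = I%:E.
  by rewrite /I /Rintegral fineK //; exact: integrable_fin_num.
under eq_fun do rewrite integral_approx.
move=> H0; have H := fine_cvg H0.
pose L := (Gamma (- a))^-1 * I.
suff : (fun n => series (fun j => Lambda a j * g j) n.+1) @ \oo --> L.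
  by rewrite (cvg_shiftS (series (fun j => Lambda a j * g j))).
set P := fun n => \prod_(k < n) (1 - a / k.+1%:R).
(* Solves the formula of [integral_approx] for the series, which is possible since Gamma(-a) < 0. *)
rewrite (_ : (fun n => series (fun j => Lambda a j * g j) n.+1) =
  (fun n => (Gamma (- a))^-1 * (Gamma (- a) * (series (fun j => Lambda a j * g j) n.+1 -
                  g 0%N * P n)) + g 0%N * P n)); last first.
  by apply/funext => n; rewrite mulKf ?subrK // lt_eqF // Gamma_opp_lt0.
rewrite -[L]addr0; apply: cvgD.
  by apply: cvgM; [exact: cvg_cst|exact: H].
rewrite -(mulr0 (g 0%N)); apply: cvgM; first exact: cvg_cst.
exact: prod_onem_div_cvg0.
Qed.

End bounded_sequence.

End Fractional_difference.

(** * The complex case *)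

Lemma ler_norm_Re (R : realType) (z : R[i]) : `|complex.Re z| <= complex.Re `|z|.
Proof. by have := normc_ge_Re z; rewrite lecE => /andP[]. Qed.

Lemma ler_norm_Im (R : realType) (z : R[i]) : `|complex.Im z| <= complex.Re `|z|.
Proof.
by rewrite normc_def /= -[X in X <= _]sqrtr_sqr ler_wsqrtr // lerDr sqr_ge0.
Qed.

Lemma ReZ (R : realType) (r : R) (z : R[i]) : complex.Re (r%:C * z) = r * complex.Re z.
Proof. by case: z => x y /=; rewrite mul0r subr0. Qed.

Lemma ImZ (R : realType) (r : R) (z : R[i]) : complex.Im (r%:C * z) = r * complex.Im z.
Proof. by case: z => x y /=; rewrite mul0r addr0. Qed.

(** [F] stands for the values f(n + j) or f(n - j), and [z] for f(n). The link between them is an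
    equation so that [addr0] or [subr0] can supply it. *)
Lemma frac_power_bounded (R : realType) (a : R) (a_gt0 : 0 < a) (a_lt1 : a < 1)
    (F : nat -> R[i]) (M : R) (FM : forall j, complex.Re `|F j| <= M)
    (z : R[i]) (Fz : F 0%N = z) :
  let w t j := (expR (- t) * (t ^+ j / j`!%:R))%:C * F j in
  let q t := (csum (w t) - z) / (t `^ (1 + a))%:C in
  [/\ (forall t : R, 0 <= t -> csummable (w t)),
      cintegrable_pos q,
      csummable (fun j => (Lambda a j)%:C * F j) &
      ((Gamma (- a))^-1)%:C * cintegral_pos q =
        csum (fun j => (Lambda a j)%:C * F j)].
Proof.
move=> w q.
pose gr j := complex.Re (F j); pose gi j := complex.Im (F j).
have grM j : `|gr j| <= M by exact: le_trans (ler_norm_Re _ _) (FM j).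
have giM j : `|gi j| <= M by exact: le_trans (ler_norm_Im _ _) (FM j).
have wr t : (fun j => complex.Re (w t j)) =
    (fun j => expR (- t) * (t ^+ j / j`!%:R) * gr j).
  by apply/funext => j; rewrite ReZ.
have wi t : (fun j => complex.Im (w t j)) =
    (fun j => expR (- t) * (t ^+ j / j`!%:R) * gi j).
  by apply/funext => j; rewrite ImZ.
have W t : 0 <= t -> csummable (w t) /\
    csum (w t) = poisson_mean R gr t +i* poisson_mean R gi t.
  move=> t0; have := @csum_complex R (w t).
  rewrite wr wi => /(_ (is_cvg_poisson_mean R gr M grM t t0)).
  by move=> /(_ (is_cvg_poisson_mean R gi M giM t t0)).
have qE t : 0 < t -> q t = frac_quotient R a gr t +i* frac_quotient R a gi t.
  (* Dividing by the real t^(1+a) is scaling by a real number, so it acts on the two components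
     separately. *)
  move=> t0; rewrite /q (W t (ltW t0)).2 -Fz -fmorphV mulrC.
  apply/eqP; rewrite eq_complex ReZ ImZ /frac_quotient /gr /gi.
  by case: (F 0%N) => x y /=; rewrite !(mulrC (_^-1)) !eqxx.
have qr : {in `]0, +oo[%classic, (fun t => complex.Re (q t)) =1 frac_quotient R a gr}.
  by move=> t /set_mem; rewrite /= in_itv /= andbT => /qE ->.
have qi : {in `]0, +oo[%classic, (fun t => complex.Im (q t)) =1 frac_quotient R a gi}.
  by move=> t /set_mem; rewrite /= in_itv /= andbT => /qE ->.
have [ir _] := frac_power_dominated R a a_gt0 a_lt1 gr M grM.
have [ii _] := frac_power_dominated R a a_gt0 a_lt1 gi M giM.
have Lr : (fun j => complex.Re ((Lambda a j)%:C * F j)) = (fun j => Lambda a j * gr j).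
  by apply/funext => j; rewrite ReZ.
have Li : (fun j => complex.Im ((Lambda a j)%:C * F j)) = (fun j => Lambda a j * gi j).
  by apply/funext => j; rewrite ImZ.
have Sr := cvg_Lambda_series R a a_gt0 a_lt1 gr M grM.
have Si := cvg_Lambda_series R a a_gt0 a_lt1 gi M giM.
have [LS LE] : csummable (fun j => (Lambda a j)%:C * F j) /\
  csum (fun j => (Lambda a j)%:C * F j) =
    limn (series (fun j => Lambda a j * gr j)) +i*
    limn (series (fun j => Lambda a j * gi j)).
  have := @csum_complex R (fun j => (Lambda a j)%:C * F j); rewrite Lr Li.
  by apply; [exact: cvgP Sr|exact: cvgP Si].
split; last 1 first.
- rewrite LE (cvg_lim (@Rhausdorff R) Sr) (cvg_lim (@Rhausdorff R) Si).
  have -> : cintegral_pos q =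
      (\int[lebesgue_measure]_(t in `]0%R, +oo[) frac_quotient R a gr t) +i*
      (\int[lebesgue_measure]_(t in `]0%R, +oo[) frac_quotient R a gi t).
    by congr (_ +i* _); apply: eq_Rintegral.
  by apply/eqP; rewrite eq_complex ReZ ImZ /= !eqxx.
- by move=> t /W[].
- split.
  + by apply: eq_integrable ir => // t t0 /=; rewrite qr.
  + by apply: eq_integrable ii => // t t0 /=; rewrite qi.
- exact: LS.
Qed.

Theorem mainTheorem7 (R : realType) (a : R) (p : \bar R) (f : int -> R[i])
    (a_gt0 : 0 < a) (a_lt1 : a < 1) (p_ge1 : (1%:E <= p)%E) (fp : in_lp p f)
    (n : int) :
  [/\ (forall t : R, 0 <= t -> csummable (T_plus_term t f n)),
      cintegrable_pos (frac_integrand (@T_plus R) a f n),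
      csummable (fun j : nat => (Lambda a j)%:C * f (n + j%:Z)) &
      delta_right_pow a f n =
        csum (fun j : nat => (Lambda a j)%:C * f (n + j%:Z))] /\
  [/\ (forall t : R, 0 <= t -> csummable (T_minus_term t f n)),
      cintegrable_pos (frac_integrand (@T_minus R) a f n),
      csummable (fun j : nat => (Lambda a j)%:C * f (n - j%:Z)) &
      delta_left_pow a f n =
        csum (fun j : nat => (Lambda a j)%:C * f (n - j%:Z))].
Proof.
have [M fM] := in_lp_bounded R p f p_ge1 fp.
split.
- exact: (frac_power_bounded R a a_gt0 a_lt1 (fun j => f (n + j%:Z)) M
    (fun j => fM _) (f n) (congr1 f (addr0 n))).
- exact: (frac_power_bounded R a a_gt0 a_lt1 (fun j => f (n - j%:Z)) M
    (fun j => fM _) (f n) (congr1 f (subr0 n))).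
Qed.
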